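(* Let $N$ be a positive integer and $a\in\{1,2,\ldots,N\}$. For formal variables $u,w$, $$1+\sum_{k\geq 2n,\ n\geq 1}G^\star_{0,N,a}(k,n,n)\,u^{k-2n}w^n=\exp\left\{\sum_{n=2}^\infty\frac{t_{N,a}(n)}{n}\,\bigl((x^\star)^n+(y^\star)^n-u^n\bigr)\right\},$$ where $x^\star,y^\star$ are determined by $x^\star+y^\star=u$ and $x^\star y^\star=-w$.
   Context: An index is a finite sequence $\mathbf{k}=(k_1,\ldots,k_n)$ of positive integers; its weight is $k_1+\cdots+k_n$, its depth is $n$, and its height is the number of $j$ with $k_j\geq 2$. It is admissible if $k_1>1$. For an admissible index, $$t^\star_{N,a}(k_1,\ldots,k_n)=\sum_{m_1\geq\cdots\geq m_n>0,\ m_i\equiv a\ (\mathrm{mod}\ N)}\frac{1}{m_1^{k_1}\cdots m_n^{k_n}},$$ and for an integer $n\ge2$, $t_{N,a}(n)=\sum_{m>0,\ m\equiv a\ (\mathrm{mod}\ N)}m^{-n}$. $I_0(k,n,s)$ is the set of admissible indices of weight $k$, depth $n$ and height $s$, and $G^\star_{0,N,a}(k,n,s)=\sum_{\mathbf{k}\in I_0(k,n,s)}t^\star_{N,a}(\mathbf{k})$. The identity is one of formal power series in $u,w$; note that $(x^\star)^n+(y^\star)^n$ is a polynomial in $u$ and $w$. *)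

(* Defs.v *)
From HB Require Import structures.
From mathcomp Require Import all_boot all_order all_algebra.
From mathcomp Require Import all_classical all_reals all_analysis.
Set Implicit Arguments.
Unset Strict Implicit.
Unset Printing Implicit Defensive.
Import Order.TTheory GRing.Theory Num.Theory.
Local Open Scope classical_set_scope.
Local Open Scope ring_scope.

(* Formal power series in two commuting variables u and w:
   [fcoef F i j] is the coefficient of u^i w^j. *)
Record fps2 (K : Type) := Fps2 { fcoef : nat -> nat -> K }.

HB.instance Definition _ K := gen_eqMixin (fps2 K).
HB.instance Definition _ K := gen_choiceMixin (fps2 K).

Lemma fps2P K (F G : fps2 K) :
  (forall i j, fcoef F i j = fcoef G i j) <-> F = G.
Proof.
split=> [|-> //]; case: F G => [f] [g] /= fg; congr Fps2.
by apply/funext => i; apply/funext => j.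
Qed.

Section Ring.
Variable K : comNzRingType.
Implicit Types F G H : fps2 K.

Definition fzero : fps2 K := Fps2 (fun _ _ => 0).
Definition fopp F := Fps2 (fun i j => - fcoef F i j).
Definition fadd F G := Fps2 (fun i j => fcoef F i j + fcoef G i j).
Definition fone : fps2 K := Fps2 (fun i j => ((i == 0%N) && (j == 0%N))%:R).
Definition fmul F G := Fps2 (fun i j =>
  \sum_(b < j.+1) \sum_(a < i.+1) fcoef F a b * fcoef G (i - a) (j - b)).
Definition fscale (c : K) F := Fps2 (fun i j => c * fcoef F i j).

Fact faddA : associative fadd.
Proof. by move=> F G H; apply/fps2P => i j /=; rewrite addrA. Qed.
Fact faddC : commutative fadd.
Proof. by move=> F G; apply/fps2P => i j /=; rewrite addrC. Qed.
Fact fadd0 : left_id fzero fadd.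
Proof. by move=> F; apply/fps2P => i j /=; rewrite add0r. Qed.
Fact faddN : left_inverse fzero fopp fadd.
Proof. by move=> F; apply/fps2P => i j /=; rewrite addNr. Qed.

HB.instance Definition _ := GRing.isZmodule.Build (fps2 K) faddA faddC fadd0 faddN.

(* The ring axioms are transported from [{poly {poly K}}] by truncation. *)
Let trunc n F : {poly {poly K}} := \poly_(j < n) \poly_(i < n) fcoef F i j.

Let truncE n F i j : (i < n)%N -> (j < n)%N -> (trunc n F)`_j`_i = fcoef F i j.
Proof. by move=> i_n j_n; rewrite coef_poly j_n coef_poly i_n. Qed.

Let eqlow n (P Q : {poly {poly K}}) :=
  forall i j, (i < n)%N -> (j < n)%N -> P`_j`_i = Q`_j`_i.

Let coefM2 (P Q : {poly {poly K}}) i j : (P * Q)`_j`_i =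
  \sum_(b < j.+1) \sum_(a < i.+1) P`_b`_a * Q`_(j - b)`_(i - a).
Proof. by rewrite coefM coef_sum; apply: eq_bigr => b _; rewrite coefM. Qed.

Let eqlowM n P P' Q Q' : eqlow n P P' -> eqlow n Q Q' -> eqlow n (P * Q) (P' * Q').
Proof.
move=> PP' QQ' i j i_n j_n; rewrite !coefM2.
apply: eq_bigr => b _; apply: eq_bigr => a _; congr (_ * _).
  by apply: PP'; [apply: leq_ltn_trans i_n | apply: leq_ltn_trans j_n];
    rewrite -ltnS.
by apply: QQ'; apply: leq_ltn_trans (leq_subr _ _) _.
Qed.

Let fmulE n F G i j : (i < n)%N -> (j < n)%N ->
  fcoef (fmul F G) i j = (trunc n F * trunc n G)`_j`_i.
Proof.
move=> i_n j_n; rewrite coefM2 /=.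
apply: eq_bigr => b _; apply: eq_bigr => a _; 
have ai : (a <= i)%N by rewrite -ltnS.
have bj : (b <= j)%N by rewrite -ltnS.
by rewrite !truncE // ?(leq_ltn_trans (leq_subr _ _)) //;
  [apply: leq_ltn_trans i_n | apply: leq_ltn_trans j_n].
Qed.

Let eqlow_fmul n F G : eqlow n (trunc n (fmul F G)) (trunc n F * trunc n G).
Proof. by move=> i j i_n j_n; rewrite truncE // (fmulE _ _ i_n j_n). Qed.

Fact fmulA : associative fmul.
Proof.
move=> F G H; apply/fps2P => i j; set n := (maxn i j).+1.
have i_n : (i < n)%N by rewrite ltnS leq_maxl.
have j_n : (j < n)%N by rewrite ltnS leq_maxr.
rewrite !(fmulE _ _ i_n j_n).
have -> := @eqlowM n _ (trunc n F) _ _ (fun _ _ _ _ => erefl)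
  (@eqlow_fmul n G H) i j i_n j_n.
have -> := @eqlowM n _ _ _ (trunc n H) (@eqlow_fmul n F G)
  (fun _ _ _ _ => erefl) i j i_n j_n.
by rewrite mulrA.
Qed.

Fact fmulC : commutative fmul.
Proof.
move=> F G; apply/fps2P => i j; set n := (maxn i j).+1.
have i_n : (i < n)%N by rewrite ltnS leq_maxl.
have j_n : (j < n)%N by rewrite ltnS leq_maxr.
by rewrite !(fmulE _ _ i_n j_n) mulrC.
Qed.

Fact fmul1 : left_id fone fmul.
Proof.
move=> F; apply/fps2P => i j /=.
rewrite big_ord_recl big_ord_recl /= mul1r !subn0 !big1 ?addr0 // => b _.
  by rewrite big1 // => a _; rewrite andbF mul0r.
by rewrite mul0r.
Qed.

Fact fmulDl : left_distributive fmul fadd.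
Proof.
move=> F G H; apply/fps2P => i j /=; rewrite -big_split.
apply: eq_bigr => b _; rewrite -big_split.
by apply: eq_bigr => a _; rewrite mulrDl.
Qed.

Fact fone_neq0 : fone != fzero.
Proof.
by apply/eqP => /fps2P/(_ 0%N 0%N) /= /eqP; rewrite oner_eq0.
Qed.

HB.instance Definition _ := GRing.Zmodule_isComNzRing.Build (fps2 K)
  fmulA fmulC fmul1 fmulDl fone_neq0.

Fact fscaleA a b F : fscale a (fscale b F) = fscale (a * b) F.
Proof. by apply/fps2P => i j /=; rewrite mulrA. Qed.
Fact fscale1 : left_id 1 fscale.
Proof. by move=> F; apply/fps2P => i j /=; rewrite mul1r. Qed.
Fact fscaleDr : right_distributive fscale +%R.
Proof. by move=> a F G; apply/fps2P => i j /=; rewrite mulrDr. Qed.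
Fact fscaleDl F : {morph fscale^~ F : a b / a + b}.
Proof. by move=> a b; apply/fps2P => i j /=; rewrite mulrDl. Qed.

HB.instance Definition _ := GRing.Zmodule_isLmodule.Build K (fps2 K)
  fscaleA fscale1 fscaleDr fscaleDl.

(* K[u,w] is represented by [{poly {poly K}}]: u is the inner variable and
   w the outer one. *)
Definition poly_u : {poly {poly K}} := 'X%:P.
Definition poly_w : {poly {poly K}} := 'X.

Definition fps_of_poly (P : {poly {poly K}}) : fps2 K :=
  Fps2 (fun i j => P`_j`_i).

Fact fps_of_poly_is_zmod_morphism : zmod_morphism fps_of_poly.
Proof. by move=> P Q; apply/fps2P => i j /=; rewrite !coefB. Qed.
Fact fps_of_poly_is_monoid_morphism : monoid_morphism fps_of_poly.
Proof.
split=> [|P Q]; apply/fps2P => i j /=; last by rewrite coefM2.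
by rewrite coef1; case: j => [|j]; rewrite ?coef1 ?andbT ?coef0 ?andbF.
Qed.
HB.instance Definition _ :=
  GRing.isZmodMorphism.Build _ _ fps_of_poly fps_of_poly_is_zmod_morphism.
HB.instance Definition _ :=
  GRing.isMonoidMorphism.Build _ _ fps_of_poly fps_of_poly_is_monoid_morphism.

Definition fps_u : fps2 K := fps_of_poly poly_u.
Definition fps_w : fps2 K := fps_of_poly poly_w.

(* Sum of a locally finite family of power series: each coefficient is a sum
   with finite support ([\sum_(i \in D)] is 0 on an infinite support). *)
Definition fps_sum (I : choiceType) (D : set I) (F : I -> fps2 K) : fps2 K :=
  Fps2 (fun i j => \sum_(x \in D) fcoef (F x) i j).

End Ring.

(* For F without constant term the family F^m / m! is locally finite, by
   [fps_exp_locally_finite] below. *)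
Definition fps_exp (K : fieldType) (F : fps2 K) : fps2 K :=
  fps_sum [set: nat] (fun m => (m`!%:R)^-1 *: F ^+ m).

Lemma fps_exp_locally_finite (K : fieldType) (F : fps2 K) :
  fcoef F 0 0 = 0 ->
  forall m i j, (i + j < m)%N -> fcoef (F ^+ m) i j = 0.
Proof.
move=> F0; elim=> [//|m IHm] i j ij_m; rewrite exprS /=.
apply: big1 => b _; apply: big1 => a _.
have [ab0|ab_gt0] := posnP (a + b)%N.
  have [-> ->] : (a : nat) = 0%N /\ (b : nat) = 0%N.
    by move/eqP: ab0; rewrite addn_eq0 => /andP[/eqP-> /eqP->].
  by rewrite F0 mul0r.
rewrite IHm ?mulr0 //.
have ai : (a <= i)%N by rewrite -ltnS.
have bj : (b <= j)%N by rewrite -ltnS.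
rewrite -(ltn_add2r (a + b)) addnACA !subnK //.
by rewrite (leq_trans ij_m) // -addn1 leq_add2l.
Qed.

Definition is_index (k : seq nat) : bool := all (fun x => 0 < x)%N k.
Definition weight (k : seq nat) : nat := sumn k.
Definition depth (k : seq nat) : nat := size k.
Definition height (k : seq nat) : nat := count (fun x => 2 <= x)%N k.
Definition admissible (k : seq nat) : bool := is_index k && (1 < head 0 k)%N.

Definition I0 (k n s : nat) : set (seq nat) :=
  [set l | [/\ admissible l, weight l = k, depth l = n & height l = s]].

Section Zeta.
Variable R : realType.

(* The summation ranges of t and tstar; both series have nonnegative terms and
   converge (n >= 2, resp. k admissible), so [fine] loses nothing. *)
Definition t (N a n : nat) : R :=
  fine (\esum_(m in [set m : nat | (0 < m)%N /\ m = a %[mod N]])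
          ((m%:R ^+ n)^-1 : R)%:E).

Definition tstar (N a : nat) (k : seq nat) : R :=
  fine (\esum_(m in [set m : (size k).-tuple nat |
                 [/\ sorted geq m, all (fun x => 0 < x)%N m
                   & all (fun x => x == a %[mod N]) m]])
          ((\prod_(i < size k) (tnth m i)%:R ^+ nth 0%N k i)^-1 : R)%:E).

Definition Gstar0 (N a k n s : nat) : R := \sum_(l \in I0 k n s) tstar N a l.

End Zeta.

(* Main.v *)
Require Import Defs.
From mathcomp Require Import all_boot all_order all_algebra.
From mathcomp Require Import all_classical all_reals all_analysis.
From mathcomp Require Import ring lra zify.
Set Implicit Arguments.
Unset Strict Implicit.
Unset Printing Implicit Defensive.
Import Order.TTheory GRing.Theory Num.Theory.
Import numFieldNormedType.Exports.
Local Open Scope classical_set_scope.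
Local Open Scope ring_scope.

(* Write m_p = a + p N and D = u d/du + 2 w d/dw. The sums truncated to indices
   below m_n have as generating series the product over p < n of
   (1 - w / (m_p (m_p - u)))^-1 = (1 - u/m_p) / ((1 - x/m_p) (1 - y/m_p)),
   whose logarithmic D-derivative is
   sum_(k >= 2) (sum_(p < n) m_p^-k) (x^k + y^k - u^k).
   Each coefficient of the resulting identity D G_n = S_n G_n is a finite
   expression, so one may let n tend to infinity; the exponential of the
   theorem satisfies the same equation D G = S G, which determines G from its
   constant term. *)

(** * Unordered sums of nonnegative terms as limits along exhausting lists *)

Lemma ler_sum_subseq (R : realType) (I : eqType) (f : I -> R) (r s : seq I) :
  (forall i, 0 <= f i) -> uniq r -> uniq s -> {subset r <= s} ->
  \sum_(i <- r) f i <= \sum_(i <- s) f i.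
Proof.
move=> f0 ur us rs; rewrite [leRHS](bigID (mem r))/= -[leRHS]/(_ + _).
rewrite -[X in _ <= X + _]big_filter -[leLHS]addr0.
apply: lerD; last by apply: sumr_ge0.
rewrite (perm_big [seq i <- s | i \in r]) //; apply: uniq_perm => //.
  exact: filter_uniq.
by move=> i; rewrite mem_filter; case: (boolP (i \in r)) => // /rs ->.
Qed.

(** Any finite subset of [D] lies in some [e n], so the unordered sum is the supremum of the
    increasing partial sums. The uniform bound [C] makes this supremum finite, so that [fine]
    preserves the limit. *)
Lemma cvg_fine_esum (R : realType) (I : choiceType) (D : set I) (f : I -> R)
    (e : nat -> seq I) (C : R) :
  (forall i, 0 <= f i) -> (forall n, uniq (e n)) ->
  (forall n, {subset e n <= e n.+1}) ->
  (forall i, D i <-> exists n, i \in e n) ->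
  (forall n, \sum_(i <- e n) f i <= C) ->
  \sum_(i <- e n) f i @[n --> \oo] --> fine (\esum_(i in D) (f i)%:E).
Proof.
move=> f0 ue eS De ub; pose u n := \sum_(i <- e n) f i.
have sub_e m n : (m <= n)%N -> {subset e m <= e n}.
  elim: n => [|n IHn]; first by rewrite leqn0 => /eqP->.
  by rewrite leq_eqVlt => /predU1P[->//|/IHn mn] i /mn /eS.
have D_e (s : seq I) : {in s, forall i, D i} -> exists n, {subset s <= e n}.
  elim: s => [|i s IHs] Ds; first by exists 0%N.
  have [j js|n sn] := IHs; first by apply: Ds; rewrite inE js orbT.
  have [m im] : exists m, i \in e m by apply/De/Ds; rewrite inE eqxx.
  exists (maxn m n) => j; rewrite inE => /predU1P[->|/sn].
    exact: sub_e (leq_maxl _ _) _ im.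
  exact: sub_e (leq_maxr _ _) j.
have esumE : (\esum_(i in D) (f i)%:E = ereal_sup (range (EFin \o u)))%E.
  apply/eqP; rewrite eq_le; apply/andP; split; apply: ge_ereal_sup.
    move=> _ [X [finX XD] <-]; rewrite fsbig_finite //= sumEFin.
    have [i|n Xn] := D_e (finmap.enum_fset (fset_set X)).
      by rewrite in_fset_set // inE => /XD.
    apply: le_trans (ereal_sup_ubound _); last by exists n.
    by rewrite lee_fin; apply: ler_sum_subseq.
  move=> _ [n _ <-]; apply: esum_ge; exists [set` e n].
    by split=> // i ie; apply/De; exists n.
  by rewrite -fsbig_seq // sumEFin.
have sup_fin : ereal_sup (range (EFin \o u)) \is a fin_num.
  rewrite ge0_fin_numE.
    apply: (@le_lt_trans _ _ C%:E); last exact: ltry.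
    by apply: ge_ereal_sup => _ [n _ <-]; rewrite lee_fin; apply: ub.
  apply: (@le_trans _ _ (u 0%N)%:E); first by rewrite lee_fin sumr_ge0.
  by apply: ereal_sup_ubound; exists 0%N.
rewrite esumE; apply: (@fine_cvg _ _ _ _ (EFin \o u)); rewrite fineK //.
apply: ereal_nondecreasing_cvgn => m n mn.
by rewrite lee_fin; apply: ler_sum_subseq => //; apply: sub_e.
Qed.

(** * Coefficients of bivariate series and the derivation D *)

Section PowerSeries.
Variable K : comNzRingType.
Implicit Types F G X : fps2 K.

Lemma fcoefD F G i j : fcoef (F + G) i j = fcoef F i j + fcoef G i j.
Proof. by []. Qed.
Lemma fcoefB F G i j : fcoef (F - G) i j = fcoef F i j - fcoef G i j.
Proof. by []. Qed.
Lemma fcoef1 i j : fcoef (1 : fps2 K) i j = ((i == 0%N) && (j == 0%N))%:R.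
Proof. by []. Qed.
Lemma fcoefZ c F i j : fcoef (c *: F) i j = c * fcoef F i j. Proof. by []. Qed.
Lemma fcoefM F G i j : fcoef (F * G) i j =
  \sum_(b < j.+1) \sum_(a < i.+1) fcoef F a b * fcoef G (i - a) (j - b).
Proof. by []. Qed.

Lemma fcoef_sum (I : Type) (r : seq I) (P : pred I) (F : I -> fps2 K) i j :
  fcoef (\sum_(k <- r | P k) F k) i j = \sum_(k <- r | P k) fcoef (F k) i j.
Proof. by elim/big_rec2: _ => // k x y _ <-. Qed.

Lemma fcoefMn F n i j : fcoef (F *+ n) i j = fcoef F i j *+ n.
Proof. by elim: n => [|n IHn]; rewrite ?mulr0n // !mulrSr fcoefD IHn. Qed.

Lemma fcoef_natM n F i j : fcoef (n%:R * F) i j = n%:R * fcoef F i j.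
Proof. by rewrite !mulr_natl fcoefMn. Qed.

Lemma fcoef_nat n i j :
  fcoef (n%:R : fps2 K) i j = n%:R *+ ((i == 0%N) && (j == 0%N)).
Proof. by rewrite -[n%:R]mulr1 fcoef_natM fcoef1 mulr_natr. Qed.

Lemma fps_u_expE n i j :
  fcoef (fps_u K ^+ n) i j = ((i == n) && (j == 0%N))%:R.
Proof.
rewrite /fps_u -rmorphXn /= /poly_u -rmorphXn /= coefC.
by case: eqP => _; rewrite ?coef0 ?andbF ?coefXn ?andbT.
Qed.

Lemma fps_uE i j : fcoef (fps_u K) i j = ((i == 1%N) && (j == 0%N))%:R.
Proof. by rewrite -[fps_u K]expr1 fps_u_expE. Qed.

Lemma fps_wE i j : fcoef (fps_w K) i j = ((i == 0%N) && (j == 1%N))%:R.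
Proof.
rewrite /fps_w /= /poly_w coefX.
by case: eqP => _; rewrite ?coef0 ?andbF ?coef1 ?andbT.
Qed.

Lemma fcoef_uM F i j :
  fcoef (fps_u K * F) i j = if i is i'.+1 then fcoef F i' j else 0.
Proof.
rewrite fcoefM big_ord_recl [X in _ + X]big1 => [|b _]; last first.
  by apply: big1 => a _; rewrite fps_uE andbF mul0r.
rewrite addr0 big_ord_recl fps_uE mul0r add0r.
case: i => [|i]; first by rewrite big_ord0.
rewrite big_ord_recl big1 => [|a _]; last by rewrite fps_uE mul0r.
by rewrite addr0 fps_uE mul1r subn0 subn1.
Qed.

Lemma fcoef_wM F i j :
  fcoef (fps_w K * F) i j = if j is j'.+1 then fcoef F i j' else 0.
Proof.
rewrite fcoefM big_ord_recl big1 ?add0r => [|a _]; last first.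
  by rewrite fps_wE andbF mul0r.
case: j => [|j]; first by rewrite big_ord0.
rewrite big_ord_recl big_ord_recl [X in _ + X + _]big1 => [|a _]; last first.
  by rewrite fps_wE mul0r.
rewrite big1 => [|b _]; last by apply: big1 => a _; rewrite fps_wE andbF mul0r.
by rewrite !addr0 fps_wE mul1r subn0 subn1.
Qed.

Lemma fps_uw_expE n m i j :
  fcoef (fps_u K ^+ n * fps_w K ^+ m) i j = ((i == n) && (j == m))%:R.
Proof.
rewrite mulrC; elim: m j => [|m IHm] j; first by rewrite mul1r fps_u_expE.
by rewrite exprS -mulrA fcoef_wM; case: j => [|j]; rewrite ?andbF // IHm.
Qed.

(** Strong induction on the total degree i + j: a series is zero once each coefficient vanishes
    whenever all those of lower total degree do. *)
Lemma fps2_eq0 X :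
  (forall i j, (forall a b, (a + b < i + j)%N -> fcoef X a b = 0) ->
     fcoef X i j = 0) -> X = 0.
Proof.
move=> HX; apply/fps2P => i j; move: {2}(i + j).+1 (ltnSn (i + j)) => n.
elim: n i j => [//|n IHn] i j ij_n; apply: HX => a b ab_ij; apply: IHn.
exact: leq_trans ab_ij _.
Qed.

(** Every term of the Cauchy product other than the one with the constant term of [F] involves a
    coefficient of [X] of smaller total degree. With [fps2_eq0] this serves both to cancel factors
    and to prove uniqueness. *)
Lemma fcoefM_low F X i j :
  (forall a b, (a + b < i + j)%N -> fcoef X a b = 0) ->
  fcoef (F * X) i j = fcoef F 0 0 * fcoef X i j.
Proof.
move=> X0; rewrite fcoefM big_ord_recl big_ord_recl /= !subn0.
rewrite !big1 ?addr0 // => b _; last first.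
  by rewrite X0 ?mulr0 // /= /bump /=; have := ltn_ord b; lia.
apply: big1 => a _; rewrite X0 ?mulr0 //= /bump /=.
by have := ltn_ord b; have := ltn_ord a; lia.
Qed.

(* The derivation u d/du + 2 w d/dw; the weight 2 of w makes x^n + y^n
   homogeneous of degree n. *)
Definition euler F : fps2 K := Fps2 (fun i j => (i + 2 * j)%:R * fcoef F i j).

Lemma fcoef_euler F i j : fcoef (euler F) i j = (i + 2 * j)%:R * fcoef F i j.
Proof. by []. Qed.

Lemma eulerB F G : euler (F - G) = euler F - euler G.
Proof. by apply/fps2P => i j; rewrite /= mulrDr mulrN. Qed.

(** The weight i + 2j is additive along the terms of the Cauchy product. *)
Lemma eulerM F G : euler (F * G) = euler F * G + F * euler G.
Proof.
apply/fps2P => i j; rewrite fcoef_euler fcoefD !fcoefM mulr_sumr -big_split.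
apply: eq_bigr => b _; rewrite mulr_sumr -big_split; apply: eq_bigr => a _ /=.
have -> : (i + 2 * j = (a + 2 * b) + ((i - a) + 2 * (j - b)))%N.
  by have := ltn_ord b; have := ltn_ord a; lia.
by rewrite natrD mulrDl mulrA; congr (_ + _); rewrite mulrCA.
Qed.

Lemma euler_nat n : euler n%:R = 0.
Proof.
apply/fps2P => i j; rewrite fcoef_euler fcoef_nat.
by case: i j => [|i] [|j]; rewrite ?mul0r ?mulr0.
Qed.

Lemma euler_u : euler (fps_u K) = fps_u K.
Proof.
apply/fps2P => i j; rewrite fcoef_euler -[fps_u K]expr1 fps_u_expE.
by case: i j => [|[|i]] [|j]; rewrite ?mulr0 ?mul1r.
Qed.

Lemma euler_w : euler (fps_w K) = 2%:R * fps_w K.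
Proof.
apply/fps2P => i j; rewrite fcoef_euler fcoef_natM.
rewrite -[fps_w K]mul1r -(expr0 (fps_u K)) -[fps_w K]expr1 fps_uw_expE.
by case: i j => [|i] [|[|j]]; rewrite ?mulr0 ?mulr1.
Qed.

Lemma eulerX F n : euler (F ^+ n.+1) = n.+1%:R * (euler F * F ^+ n).
Proof.
elim: n => [|n IHn]; first by rewrite mulr1 mul1r.
rewrite exprS eulerM IHn -natr1 exprS; ring.
Qed.

End PowerSeries.

(** * Cancellation, uniqueness for D F = H F, and the exponential *)

Section Field.
Variable K : numFieldType.
Implicit Types F G H X : fps2 K.

Lemma fps2_mulfI F X : fcoef F 0 0 != 0 -> F * X = 0 -> X = 0.
Proof.
move=> F0 FX; apply: fps2_eq0 => i j X0.
have := fcoefM_low F X0; rewrite FX => /esym/eqP.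
by rewrite mulf_eq0 (negPf F0) => /eqP.
Qed.

(** The difference X of two solutions satisfies D X = H X. At a coefficient of lowest total degree
    the right side vanishes since H has no constant term, while D multiplies by i + 2j, which is
    nonzero away from (0, 0); at (0, 0) the constant terms agree. *)
Lemma euler_uniq H F G : fcoef H 0 0 = 0 -> fcoef F 0 0 = fcoef G 0 0 ->
  euler F = H * F -> euler G = H * G -> F = G.
Proof.
move=> H0 FG0 HF HG; apply/eqP; rewrite -subr_eq0; apply/eqP.
apply: fps2_eq0 => i j X0.
have : fcoef (euler (F - G)) i j = 0.
  by rewrite eulerB HF HG -mulrBr (fcoefM_low H X0) H0 mul0r.
rewrite fcoef_euler => /eqP; rewrite mulf_eq0 pnatr_eq0 => /orP[|/eqP//].
by case: i j {X0} => [|i] [|j] // _; rewrite fcoefB FG0 subrr.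
Qed.

Section Exp.
Variable F : fps2 K.
Hypothesis F0 : fcoef F 0 0 = 0.

Lemma fps_exp_trunc n i j : (i + j < n)%N ->
  fcoef (fps_exp F) i j = fcoef (\sum_(m < n) (m`!%:R)^-1 *: F ^+ m) i j.
Proof.
move=> ijn; rewrite /= (fsbigE (iota 0 n)) ?iota_uniq //=.
  rewrite fcoef_sum -(big_mkord xpredT (fun m => (m`!%:R)^-1 * fcoef (F ^+ m) i j)).
  rewrite /index_iota subn0; apply: eq_bigl => m; exact: mem_setT.
move=> m _; rewrite mem_iota /= add0n -leqNgt => nm.
by rewrite fps_exp_locally_finite ?mulr0 // (leq_trans ijn).
Qed.

(** D sends F^(m+1) / (m+1)! to D F times F^m / m! and kills the term m = 0, so this is a
    computation on truncations. *)
Lemma euler_exp : euler (fps_exp F) = euler F * fps_exp F.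
Proof.
apply/fps2P => i j; set n := (i + j).+1.
(* One more term than total degree i + j requires: differentiation drops the term m = 0 and leaves
   [n] terms, still enough for all coefficients met below. *)
rewrite fcoef_euler (@fps_exp_trunc n.+1) //.
rewrite -fcoef_euler.
have -> : euler (\sum_(m < n.+1) (m`!%:R)^-1 *: F ^+ m) =
          euler F * \sum_(m < n) (m`!%:R)^-1 *: F ^+ m.
  apply/fps2P => a b.
  rewrite fcoef_euler big_ord_recl fcoefD mulrDr fcoefZ expr0 fcoef1 mulrCA.
  have -> : (a + 2 * b)%:R * ((a == 0%N) && (b == 0%N))%:R = 0 :> K.
    by case: a b => [|a] [|b]; rewrite ?mulr0 ?mul0r.
  rewrite mulr0 add0r mulr_sumr !fcoef_sum mulr_sumr; apply: eq_bigr => m _.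
  rewrite fcoefZ mulrCA -fcoef_euler lift0 eulerX fcoef_natM factS natrM invfM.
  rewrite mulrACA mulVf ?pnatr_eq0 // mul1r.
  rewrite !fcoefM mulr_sumr; apply: eq_bigr => d _.
  by rewrite mulr_sumr; apply: eq_bigr => c _; rewrite fcoefZ mulrCA.
rewrite !fcoefM; apply: eq_bigr => b _; apply: eq_bigr => a _.
rewrite (@fps_exp_trunc n) // /n.
by have := ltn_ord b; have := ltn_ord a; lia.
Qed.

Lemma fps_exp00 : fcoef (fps_exp F) 0 0 = 1.
Proof.
by rewrite (@fps_exp_trunc 1) // big_ord1 fcoefZ expr0 fcoef1 fact0 invr1 mulr1.
Qed.

End Exp.
End Field.

(** * Power sums of x and y as polynomials in u and w *)

(* [x ^+ n + y ^+ n] when [x + y = u] and [x * y = - w]. *)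
Fixpoint power_sum (K : comNzRingType) n : {poly {poly K}} :=
  match n with
  | 0 => 2%:R
  | n1.+1 => match n1 with
    | 0 => poly_u K
    | n2.+1 => poly_u K * power_sum K n1 + poly_w K * power_sum K n2
    end
  end.

Lemma power_sumSS (K : comNzRingType) n : power_sum K n.+2 =
  poly_u K * power_sum K n.+1 + poly_w K * power_sum K n.
Proof. by []. Qed.

(** Both x and y are roots of T^2 = u T + w, so their power sums obey the recurrence defining
    [power_sum]; the induction carries two consecutive values. *)
Lemma power_sumE (K L : comNzRingType) (iota : {rmorphism {poly {poly K}} -> L})
    (x y : L) n :
  x + y = iota (poly_u K) -> x * y = - iota (poly_w K) ->
  iota (power_sum K n) = x ^+ n + y ^+ n.
Proof.
move=> xyu xyw; have wE : iota (poly_w K) = - (x * y) by rewrite xyw opprK.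
suff [] : iota (power_sum K n) = x ^+ n + y ^+ n /\
  iota (power_sum K n.+1) = x ^+ n.+1 + y ^+ n.+1 by [].
elim: n => [|n [IH0 IH1]]; first by rewrite rmorph_nat xyu.
split=> //; rewrite power_sumSS rmorphD !rmorphM IH0 IH1 wE -xyu !exprS; ring.
Qed.

Section PowerSumSeries.
Variable K : comNzRingType.
Local Notation u := (fps_u K).
Local Notation w := (fps_w K).
Local Notation pw n := (fps_of_poly (power_sum K n)).

Lemma fps_power_sumSS n : pw n.+2 = u * pw n.+1 + w * pw n.
Proof. by rewrite power_sumSS rmorphD !rmorphM. Qed.

Lemma fps_power_sum0 : pw 0 = 2%:R.
Proof. by rewrite rmorph_nat. Qed.

(** The recurrence respects the grading in which u has weight 1 and w has weight 2. *)
Lemma power_sum_homog n i j : (i + 2 * j)%N != n -> fcoef (pw n) i j = 0.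
Proof.
suff [] : ((i + 2 * j)%N != n -> fcoef (pw n) i j = 0) /\
  ((i + 2 * j)%N != n.+1 -> fcoef (pw n.+1) i j = 0) by [].
elim: n i j => [|n IHn] i j.
  split; first by rewrite fps_power_sum0 fcoef_nat; case: i j => [|i] [|j].
  by rewrite -[pw 1]/u fps_uE; case: i j => [|[|i]] [|j].
split=> [|ij]; first by case: (IHn i j).
rewrite fps_power_sumSS fcoefD fcoef_uM fcoef_wM.
rewrite [X in X + _](_ : _ = 0) ?[X in _ + X](_ : _ = 0) ?addr0 //.
  by case: j ij => [//|j] ij; have [+ _] := IHn i j; apply; lia.
by case: i ij => [//|i] ij; have [_] := IHn i j; apply; lia.
Qed.

End PowerSumSeries.

(** * The factor attached to one integer m and its logarithmic derivative *)

Section LocalFactor.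
Variables (K : numFieldType) (m : nat).
Hypothesis m_gt0 : (0 < m)%N.
Implicit Types F G S : fps2 K.
Local Notation u := (fps_u K).
Local Notation w := (fps_w K).
Local Notation pw n := (fps_of_poly (power_sum K n)).

(* The generating functions of [(x^n + y^n) / m^n] and [u^n / m^n], of
   [1 / (m (m - u))], and the logarithmic derivative of
   [(1 - u/m) / ((1 - x/m) (1 - y/m))], where [- 1] removes the term n = 0. *)
Definition gen_power_sum : fps2 K :=
  Fps2 (fun i j => m%:R ^- (i + 2 * j) * fcoef (pw (i + 2 * j)) i j).
Definition gen_u : fps2 K := Fps2 (fun i j => m%:R ^- i *+ (j == 0%N)).
Definition local_inv : fps2 K := Fps2 (fun i j => m%:R ^- i.+2 *+ (j == 0%N)).
Definition local_dlog : fps2 K := gen_power_sum - gen_u - 1.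

Let m0 : m%:R != 0 :> K. Proof. by rewrite pnatr_eq0 -lt0n. Qed.

(** This is 1/(1 - x/m) + 1/(1 - y/m) = (2 - u/m) / (1 - u/m - w/m^2), with denominators cleared by
    m^2. *)
Lemma gen_power_sumE :
  gen_power_sum * (m%:R * m%:R - u * m%:R - w) = 2%:R * m%:R * m%:R - u * m%:R.
Proof.
rewrite mulrC 2!mulrBl -!mulrA [u * m%:R]mulrC.
apply/fps2P => i j; rewrite !fcoefB fcoef_uM fcoef_wM !fcoef_natM fps_uE.
rewrite fcoef_nat.
have genE k a b : (a + 2 * b)%N = k ->
    fcoef gen_power_sum a b = m%:R ^- k * fcoef (pw k) a b by move=> <-.
(* In weight at least 2 the right side vanishes and the claim is the recurrence of the power sums;
   weights 0 and 1 are its initial values. *)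
have [[n ijn]|ij2] : (exists n, i + 2 * j = n.+2)%N \/ (i + 2 * j < 2)%N.
  by case: (i + 2 * j)%N => [|[|n]]; [right|right|left; exists n].
  rewrite [RHS](_ : _ = 0); last first.
    by case: i j ijn => [|[|i]] [|j] // _; rewrite !mulr0 subrr.
  rewrite (genE n.+2) // fps_power_sumSS fcoefD fcoef_uM fcoef_wM.
  have -> : (if i is i'.+1 then fcoef (m%:R * gen_power_sum) i' j else 0) =
      m%:R ^- n * (if i is i'.+1 then fcoef (pw n.+1) i' j else 0).
    case: i ijn => [|i] ijn; first by rewrite mulr0.
    rewrite fcoef_natM (genE n.+1); last by lia.
    by rewrite exprS invfM 2!mulrA mulfV // mul1r.
  have -> : (if j is j'.+1 then fcoef gen_power_sum i j' else 0) =
      m%:R ^- n * (if j is j'.+1 then fcoef (pw n) i j' else 0).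
    case: j ijn => [|j] ijn; first by rewrite mulr0.
    by rewrite (genE n) //; lia.
  move: (if i is i'.+1 then fcoef (pw n.+1) i' j else 0) => c1.
  move: (if j is j'.+1 then fcoef (pw n) i j' else 0) => c2.
  by rewrite !exprS; field; rewrite m0 expf_neq0.
case: j ij2 => [|j] ij2; last by lia.
case: i ij2 => [|[|i]] // _.
  by rewrite (genE 0%N) // fps_power_sum0 fcoef_nat /=; field.
rewrite (genE 1%N) // fcoef_natM (genE 0%N) // fps_power_sum0 fcoef_nat.
by rewrite -[pw 1]/u fps_uE /=; field.
Qed.

Lemma gen_uE : gen_u * (m%:R * m%:R - u * m%:R) = m%:R * m%:R.
Proof.
rewrite mulrC mulrBl -!mulrA.
apply/fps2P => i j; rewrite !fcoefB fcoef_uM !fcoef_natM fcoef_nat.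
case: j => [|j]; last first.
  by case: i => [|i]; lazy iota; rewrite ?fcoef_natM /= !mulr0n !mulr0 subr0.
case: i => [|i]; lazy iota; rewrite ?fcoef_natM /=.
  by rewrite !mulr1n expr0 invr1 subr0 mulr1.
by rewrite !mulr1n mulr0n exprS invfM !mulrA mulfK // mulr0 subrr.
Qed.

Lemma local_invE : local_inv * (m%:R * m%:R - u * m%:R) = 1.
Proof.
rewrite mulrC mulrBl -!mulrA.
apply/fps2P => i j; rewrite !fcoefB fcoef_uM !fcoef_natM fcoef1.
case: j => [|j]; last first.
  by case: i => [|i]; lazy iota; rewrite ?fcoef_natM /= !mulr0n !mulr0 subr0.
case: i => [|i]; lazy iota; rewrite ?fcoef_natM /=.
  by rewrite subr0 mulr1n expr2 mulrA mulfV // mulf_neq0.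
by rewrite !mulr1n [_ ^+ i.+3]exprS invfM !mulrA mulfK // subrr.
Qed.

(** The weights 0 and 1 cancel: 2 - 1 - 1 = 0 and u - u = 0. Only exponents at least 2 remain, those
    for which the series defining [t] converges. *)
Lemma local_dlogE i j : fcoef local_dlog i j =
  if (i + 2 * j < 2)%N then 0 else
  m%:R ^- (i + 2 * j) * fcoef (pw (i + 2 * j) - u ^+ (i + 2 * j)) i j.
Proof.
rewrite !fcoefB fps_u_expE fcoef1.
have genuE : fcoef gen_u i j =
    m%:R ^- (i + 2 * j) * ((i == i + 2 * j)%N && (j == 0%N))%:R.
  by case: j => [|j]; rewrite /= ?andbF ?mulr0 // addn0 eqxx mulr1.
have gen_pE : fcoef gen_power_sum i j =
  m%:R ^- (i + 2 * j) * fcoef (pw (i + 2 * j)) i j by [].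
rewrite genuE gen_pE -mulrBr {genuE gen_pE}; case: ltnP => [ij2|ij2]; last first.
  by case: i j ij2 => [|i] [|j] // _; rewrite subr0.
case: j ij2 => [|j] ij2; last by lia.
case: i ij2 => [|[|i]] // _.
  by rewrite fps_power_sum0 fcoef_nat /=; field.
by rewrite -[pw _]/u fps_uE /=; field.
Qed.

(** With r = m^2 - u m and q = r - w, the hypothesis says G' q = G r, so D G'/G' = S + D r/r - D
    q/q. Here D r/r = 1 - m^2/r and - D q/q = (2 m^2 - u m)/q - 2, which add up to [local_dlog]. *)
Lemma euler_local_step S G G' :
  G' = G + w * (local_inv * G') -> euler G = S * G ->
  euler G' = (S + local_dlog) * G'.
Proof.
move=> G'E dG; set M : fps2 K := m%:R.
pose r := M * M - u * M; pose q := r - w.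
have GE : G' * q = G * r.
  have -> : G = G' - w * (local_inv * G') by rewrite {1}G'E addrK.
  transitivity (G' * r - w * G' * (local_inv * r)); last by ring.
  by rewrite local_invE /q; ring.
have dr : euler r = - (u * M).
  by rewrite /r eulerB !eulerM euler_u /M euler_nat; ring.
have dq : euler q = - (u * M) - 2%:R * w.
  by rewrite /q eulerB dr euler_w.
have dG' : euler G' * q = S * (G' * q) + G * euler r - G' * euler q.
  have := congr1 (@euler K) GE; rewrite !eulerM dG => /(canRL (addrK _)) ->.
  by rewrite GE; ring.
apply/eqP; rewrite -subr_eq0; apply/eqP.
(* The factor q r has constant term m^4, which is nonzero, so it may be multiplied in to clear all
   denominators; what remains is a ring identity. *)
apply: (@fps2_mulfI _ (q * r)).
  rewrite fcoefM !big_ord1 /q !fcoefB fcoef_uM -[fps_w K]mulr1 fcoef_wM.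
  by rewrite /M fcoef_natM fcoef_nat !subr0 !mulf_neq0.
have Aq : gen_power_sum * q = 2%:R * M * M - u * M by exact: gen_power_sumE.
have Br : gen_u * r = M * M by exact: gen_uE.
transitivity (euler G' * q * r - S * (G' * q) * r
   - ((gen_power_sum * q) * r - (gen_u * r) * q - q * r) * G').
  by rewrite /local_dlog; ring.
rewrite dG' Aq Br dr dq.
transitivity ((S * (G' * q)) * r - (G * r) * (u * M) + G' * (u * M + 2%:R * w) * r
  - S * (G' * q) * r - ((2%:R * M * M - u * M) * r - M * M * q - q * r) * G').
  by ring.
by rewrite -GE /q /r; ring.
Qed.

End LocalFactor.

(** * Truncated sums over the progression a + p N and their convergence *)

Section StarSums.
Variables (R : realType) (N a : nat).
Hypotheses (N_gt0 : (0 < N)%N) (a_gt0 : (0 < a)%N).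

Definition prog p := (a + p * N)%N.

Lemma prog_gt p : (p < prog p)%N.
Proof. by rewrite /prog; nia. Qed.

Lemma leq_prog p q : (prog p <= prog q)%N = (p <= q)%N.
Proof. by rewrite leq_add2l leq_mul2r; case: N N_gt0. Qed.

Lemma prog_inj : injective prog.
Proof. by move=> p q /eqP; rewrite eqn_leq !leq_prog -eqn_leq => /eqP. Qed.

(** Since 1 <= a <= N, the least positive integer in the class of a is a itself. *)
Lemma progP m : (a <= N)%N ->
  reflect (exists p, m = prog p) ((0 < m)%N && (m == a %[mod N])).
Proof.
move=> aN; apply: (iffP andP) => [[m0 ma]|[p ->]]; last first.
  by rewrite (leq_ltn_trans _ (prog_gt p)) // /prog addnC modnMDl.
have am : (a <= m)%N.
  rewrite leqNgt; apply/negP => ltma; move: ma.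
  have ltmN : (m < N)%N by apply: leq_trans aN.
  (* The case a = N is separate, because the residue of a is then 0 instead of a. *)
  rewrite (modn_small ltmN); move: aN; rewrite leq_eqVlt => /predU1P[->|aN].
    by rewrite modnn => /eqP mN; rewrite mN in m0.
  by rewrite modn_small // => /eqP mN; rewrite mN ltnn in ltma.
move: ma; rewrite eqn_mod_dvd // => /dvdnP[p mE].
by exists p; rewrite /prog -mE subnKC.
Qed.

Definition progs n := [seq prog p | p <- iota 0 n].

Lemma mem_progs n p : (prog p \in progs n) = (p < n)%N.
Proof. by rewrite mem_map ?mem_iota //; exact: prog_inj. Qed.

Lemma progsP n m : reflect (exists2 p, (p < n)%N & m = prog p) (m \in progs n).
Proof.
apply: (iffP mapP) => -[p pn ->]; exists p => //; first by rewrite mem_iota in pn.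
by rewrite mem_iota.
Qed.

Lemma progs_uniq n : uniq (progs n).
Proof. by rewrite map_inj_uniq ?iota_uniq //; exact: prog_inj. Qed.

Lemma sub_progs n : {subset progs n <= progs n.+1}.
Proof. by move=> m /progsP[p pn ->]; rewrite mem_progs ltnW. Qed.

Lemma mem_progs_le n p m : (p < n)%N ->
  (m <= prog p)%N && (m \in progs n) = (m \in progs p.+1).
Proof.
move=> pn; apply/andP/progsP => [[mp /progsP[q qn mq]]|[q qp ->]].
  by exists q => //; rewrite ltnS -leq_prog -mq.
by rewrite leq_prog mem_progs -ltnS qp (leq_trans qp).
Qed.

(** The largest entry is chosen first. The bound [p.+1], not [p], lets the next entry equal it, as
    the weak inequalities of star sums require. *)
Fixpoint star_tuples d n : seq (d.-tuple nat) :=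
  if d is d'.+1 then
    [seq cons_tuple (prog p) s | p <- iota 0 n, s <- star_tuples d' p.+1]
  else [:: [tuple]].

Lemma mem_star_tuples d n (s : d.-tuple nat) :
  (s \in star_tuples d n) = sorted geq s && all [in progs n] s.
Proof.
elim: d n s => [|d IHd] n s; first by rewrite tuple0.
case/tupleP: s => x s /=.
rewrite (path_sortedE (rev_trans leq_trans)).
have allE p : (p < n)%N -> all (geq (prog p)) s && all [in progs n] s =
    all [in progs p.+1] s.
  by move=> pn; rewrite -all_predI; apply: eq_all => y; exact: mem_progs_le.
apply/allpairsPdep/idP => [[p [s' [+ + /(congr1 val)/= xs]]]|].
  case: xs => -> /val_inj <-; rewrite mem_iota /= add0n mem_progs => pn.
  by rewrite IHd -allE // => /andP[-> /andP[-> ->]]; rewrite pn.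
case/andP => /andP[xs s_sorted] /andP[/progsP[p pn xp] sn].
exists p, s; rewrite mem_iota pn IHd s_sorted -allE // -xp xs sn.
by split=> //; apply: val_inj; rewrite /= xp.
Qed.

Lemma all_progs s : (a <= N)%N ->
  all (leq 1) s -> all (fun m => m == a %[mod N]) s ->
  exists n, all [in progs n] s.
Proof.
move=> aN; elim: s => [|m s IHs]; first by exists 0%N.
case/andP=> m0 s0 /andP[ma sa]; have [n sn] := IHs s0 sa.
have [p ->] : exists p, m = prog p by apply/(progP _ aN); rewrite m0 ma.
exists (maxn p.+1 n); rewrite /= mem_progs leq_maxl /=.
apply/allP => x /(allP sn) /progsP[q qn ->].
by rewrite mem_progs (leq_trans qn) // leq_maxr.
Qed.

Lemma star_tuples_uniq d n : uniq (star_tuples d n).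
Proof.
elim: d n => [//|d IHd] n; apply: allpairs_uniq_dep => //.
  exact: iota_uniq.
move=> [p s] [q s'] _ _ /= /(congr1 val) /= [/prog_inj-> /val_inj->].
done.
Qed.

Fixpoint star_trunc (l : seq nat) n : R :=
  if l is k :: l' then \sum_(p < n) (prog p)%:R ^- k * star_trunc l' p.+1 else 1.

Lemma star_truncE l n :
  \sum_(s <- star_tuples (size l) n)
    (\prod_(i < size l) (tnth s i)%:R ^+ nth 0%N l i)^-1 = star_trunc l n.
Proof.
elim: l n => [|k l IHl] n; first by rewrite big_seq1 big_ord0 invr1.
rewrite /= big_allpairs_dep /= -(big_mkord xpredT
  (fun p => (prog p)%:R ^- k * star_trunc l p.+1)) /index_iota subn0.
apply: eq_bigr => p _; rewrite -IHl mulr_sumr; apply: eq_bigr => s _.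
rewrite big_ord_recl invfM tnth0; congr (_ * _^-1).
by apply: eq_bigr => i _; rewrite tnthS.
Qed.

Lemma prog_exp_le p k : (2 <= k)%N -> (prog p)%:R ^- k <= p.+1%:R ^- 2 :> R.
Proof.
move=> k2; rewrite lef_pV2 ?posrE ?exprn_gt0 ?ltr0n //; last first.
  exact: leq_ltn_trans (prog_gt p).
apply: (@le_trans _ _ (p.+1%:R ^+ k)).
  by apply: ler_weXn2l => //; rewrite ler1n.
by apply: lerXn2r; rewrite ?nnegrE ?ler0n // ler_nat prog_gt.
Qed.

Lemma sum_inv_sq_le n : \sum_(p < n) p.+1%:R ^- 2 <= 2%:R :> R.
Proof.
(* The sharper bound 2 - 1/(n+1) is inductive, as 1/(n+2)^2 <= 1/(n+1) - 1/(n+2); the gap is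
   1/((n+1)(n+2)^2). *)
suff : \sum_(p < n.+1) p.+1%:R ^- 2 <= 2%:R - n.+1%:R^-1 :> R.
  rewrite big_ord_recr /= => H; apply: le_trans (_ : 2 - n.+1%:R^-1 <= _).
    by apply: le_trans H; rewrite lerDl invr_ge0 exprn_ge0.
  by rewrite gerBl invr_ge0.
elim: n => [|n IHn]; first by rewrite big_ord1 /= expr1n invr1; lra.
rewrite big_ord_recr /=; apply: le_trans (lerD IHn (lexx _)) _.
have n0 : 0 <= n%:R :> R by rewrite ler0n.
rewrite -[n.+2]addn2 -[n.+1]addn1 !natrD -subr_ge0.
rewrite (_ : _ - _ = ((n%:R + 1) * (n%:R + 2) ^+ 2)^-1).
  by rewrite invr_ge0 mulr_ge0 ?exprn_ge0; lra.
by field; rewrite !lt0r_neq0 //; lra.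
Qed.

Lemma sum_prog_le n k : (2 <= k)%N -> \sum_(p < n) (prog p)%:R ^- k <= 2%:R :> R.
Proof.
move=> k2; apply: le_trans (sum_inv_sq_le n).
by apply: ler_sum => p _; exact: prog_exp_le.
Qed.

(** Each nested summation costs a factor at most 2, as all exponents are at least 2. The bound is
    uniform in [n], as [cvg_fine_esum] needs. *)
Lemma star_trunc_bound l n : all (leq 2) l ->
  0 <= star_trunc l n <= 2%:R ^+ size l.
Proof.
elim: l n => [|k l IHl] n /=; first by rewrite ler01 lexx.
move=> /andP[k2 l2]; apply/andP; split.
  apply: sumr_ge0 => p _; rewrite mulr_ge0 ?invr_ge0 ?exprn_ge0 //.
  by case/andP: (IHl p.+1 l2).
rewrite exprS; apply: (@le_trans _ _
    (\sum_(p < n) (prog p)%:R ^- k * 2%:R ^+ size l)).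
  apply: ler_sum => p _; apply: ler_wpM2l; first by rewrite invr_ge0 exprn_ge0.
  by case/andP: (IHl p.+1 l2).
by rewrite -mulr_suml; apply: ler_wpM2r; rewrite ?exprn_ge0 // sum_prog_le.
Qed.

Hypothesis aN : (a <= N)%N.

Lemma cvg_t n : (2 <= n)%N ->
  \sum_(p < M) (prog p)%:R ^- n @[M --> \oo] --> t R N a n.
Proof.
move=> n2.
rewrite (_ : (fun M => _) = (fun M => \sum_(m <- progs M) m%:R ^- n)); last first.
  apply/funext => M; rewrite big_map.
  by rewrite -(big_mkord xpredT (fun p => (prog p)%:R ^- n)) /index_iota subn0.
apply: (@cvg_fine_esum _ _ _ _ progs 2%:R).
- by move=> m; rewrite invr_ge0 exprn_ge0.
- exact: progs_uniq.
- exact: sub_progs.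
- move=> m; split.
    move=> /= [m0 ma]; have [p ->] : exists p, m = prog p.
      by apply/(progP _ aN); rewrite m0 ma eqxx.
    by exists p.+1; rewrite mem_progs.
  move=> [M /progsP[p _ mp]].
  have /(progP _ aN)/andP[m0 /eqP ma] : exists p, m = prog p by exists p.
  by split.
move=> M; rewrite big_map; have := sum_prog_le M n2.
by rewrite -(big_mkord xpredT (fun p => (prog p)%:R ^- n)) /index_iota subn0.
Qed.

Lemma cvg_tstar l : all (leq 2) l -> star_trunc l M @[M --> \oo] --> tstar R N a l.
Proof.
move=> l2; under eq_fun do rewrite -star_truncE.
apply: (@cvg_fine_esum _ _ _ _ (star_tuples (size l)) (2%:R ^+ size l)).
- by move=> s; rewrite invr_ge0 prodr_ge0 // => i _; rewrite exprn_ge0.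
- exact: star_tuples_uniq.
- move=> M s; rewrite !mem_star_tuples => /andP[-> /allP sM].
  by apply/allP => x /sM; exact: sub_progs.
- move=> s; split=> [[s_sorted s0 sa]|[M]].
    have [M sM] := all_progs aN s0 sa.
    by exists M; rewrite mem_star_tuples s_sorted.
  rewrite mem_star_tuples => /andP[s_sorted /allP sM].
  have sP x : x \in val s -> (0 < x)%N && (x == a %[mod N]).
    by move=> /sM /progsP[p _ xp]; apply/(progP _ aN); exists p.
  by split=> //; apply/allP => x /sP /andP[].
by move=> M; rewrite star_truncE; case/andP: (star_trunc_bound M l2).
Qed.

End StarSums.

(** * Indices of full height *)

(** Here [i] is the total excess of the entries over 2, that is k - 2n for weight k and depth n,
    hence the exponent of u. *)
Fixpoint compositions d i : seq (seq nat) :=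
  if d is d'.+1 then
    [seq e.+2 :: l | e <- iota 0 i.+1, l <- compositions d' (i - e)%N]
  else if i == 0%N then [:: [::]] else [::].

Lemma compositionsS d i : compositions d.+1 i =
  [seq e.+2 :: l | e <- iota 0 i.+1, l <- compositions d (i - e)%N].
Proof. by []. Qed.

Lemma mem_compositions d i l : (l \in compositions d i) =
  [&& size l == d, all (leq 2) l & sumn l == (i + 2 * d)%N].
Proof.
elim: d i l => [|d IHd] i l.
  by case: i => [|i]; case: l => [|k l] //=; rewrite inE.
rewrite compositionsS; apply/allpairsPdep/idP => [[e [l' [+ + ->]]]|].
  rewrite mem_iota IHd /= => ei /and3P[/eqP-> -> /eqP->].
  by rewrite eqxx /=; apply/eqP; lia.
case: l => [//|k l] /and3P[dl /andP[k2 l2] /eqP kl].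
rewrite /= in dl kl.
(* This leaves the head an excess of at most [i], so that the truncated subtractions are exact. *)
have l_ge : (2 * d <= sumn l)%N.
  move: dl; rewrite eqSS => /eqP <-; elim: l l2 {kl} => [//|x l IHl] /= /andP[x2].
  by move=> /IHl; lia.
exists (k - 2)%N, l; split.
- by rewrite mem_iota; lia.
- by rewrite IHd (l2 : all (leq 2) l) -(eqSS _ d) dl /=; apply/eqP; lia.
by congr (_ :: _); lia.
Qed.

Lemma compositions_uniq d i : uniq (compositions d i).
Proof.
elim: d i => [|d IHd] i; first by case: i.
apply: allpairs_uniq_dep => // [|[e l] [e' l'] _ _ /= [-> ->] //].
exact: iota_uniq.
Qed.

(** Height equal to depth means that all entries are at least 2; as the index is nonempty,
    admissibility follows. *)
Lemma I0_full_height d i :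
  I0 (i + 2 * d.+1) d.+1 d.+1 = [set` compositions d.+1 i].
Proof.
apply/seteqP; split=> l; rewrite /I0 /mkset mem_compositions.
  move=> [_ <- <- hl]; rewrite !eqxx andbT /= all_count.
  by apply/eqP; exact: hl.
move=> /and3P[/eqP sl l2 /eqP wl]; split=> //; last first.
  by rewrite /height -sl; apply/eqP; rewrite -all_count.
case: l sl l2 {wl} => [//|k l] _ /= /andP[k2 l2].
rewrite /admissible /is_index /= k2 (ltnW k2) andbT.
by apply/allP => x /(allP l2); exact: ltnW.
Qed.

Lemma Gstar0E (R : realType) N a d i : Gstar0 R N a (i + 2 * d.+1) d.+1 d.+1 =
  \sum_(l <- compositions d.+1 i) tstar R N a l.
Proof. by rewrite /Gstar0 I0_full_height -fsbig_seq // compositions_uniq. Qed.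

Lemma cvg_sumr (R : realType) (I : eqType) (r : seq I) (f : I -> nat -> R)
    (b : I -> R) : (forall i, i \in r -> f i n @[n --> \oo] --> b i) ->
  \sum_(i <- r) f i n @[n --> \oo] --> \sum_(i <- r) b i.
Proof.
elim: r => [|i r IHr] fb.
  by under eq_fun do rewrite big_nil; rewrite big_nil; exact: cvg_cst.
under eq_fun do rewrite big_cons; rewrite big_cons; apply: cvgD.
  by apply: fb; rewrite inE eqxx.
by apply: IHr => j jr; apply: fb; rewrite inE jr orbT.
Qed.

(** * Generating series of truncated sums and passage to the limit *)

Section Truncations.
Variables (R : realType) (N a : nat).
Hypotheses (N_gt0 : (0 < N)%N) (a_gt0 : (0 < a)%N) (aN : (a <= N)%N).
Local Notation prog p := (prog N a p).

Definition gen_star_trunc n : fps2 R :=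
  Fps2 (fun i j => \sum_(l <- compositions j i) star_trunc R N a l n).

Lemma gen_star_truncE n i j : fcoef (gen_star_trunc n) i j =
  \sum_(l <- compositions j i) star_trunc R N a l n.
Proof. by []. Qed.

Lemma gen_star_trunc_j0 n i :
  fcoef (gen_star_trunc n) i 0 = (i == 0%N)%:R.
Proof. by case: i => [|i]; rewrite gen_star_truncE /= ?big_seq1 ?big_nil. Qed.

(** The new tuples are those whose largest entry is m_n. Summing over the exponent of this entry
    gives w / (m_n (m_n - u)), and the remaining entries may again equal m_n, whence
    [gen_star_trunc n.+1] on the right too. *)
Lemma gen_star_truncS n : gen_star_trunc n.+1 = gen_star_trunc n +
  fps_w R * (local_inv R (prog n) * gen_star_trunc n.+1).
Proof.
apply/fps2P => i j; rewrite fcoefD fcoef_wM.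
case: j => [|j]; first by rewrite !gen_star_trunc_j0 addr0.
rewrite fcoefM big_ord_recl [X in _ + (_ + X)]big1 => [|b _]; last first.
  by apply: big1 => c _; rewrite /= mulr0n mul0r.
rewrite addr0 subn0 !gen_star_truncE compositionsS !big_allpairs_dep.
rewrite -[iota 0 i.+1]/(index_iota 0 i.+1) !big_mkord -big_split.
apply: eq_bigr => e _; rewrite mulr_sumr -big_split; apply: eq_bigr => l _ /=.
by rewrite big_ord_recr mulr1n.
Qed.

Lemma gen_star_trunc0 : gen_star_trunc 0 = 1.
Proof.
apply/fps2P => i [|j]; rewrite fcoef1; first by rewrite gen_star_trunc_j0 andbT.
rewrite andbF gen_star_truncE compositionsS big_allpairs_dep big1 // => e _.
by rewrite big1 // => l _; rewrite /= big_ord0.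
Qed.

Lemma euler_gen_star_trunc n : euler (gen_star_trunc n) =
  (\sum_(p < n) local_dlog R (prog p)) * gen_star_trunc n.
Proof.
elim: n => [|n IHn].
  by rewrite gen_star_trunc0 [LHS](euler_nat R 1) big_ord0 mul0r.
rewrite big_ord_recr /=; apply: euler_local_step IHn; last exact: gen_star_truncS.
exact: leq_ltn_trans (prog_gt N_gt0 a_gt0 n).
Qed.

Definition exponent : fps2 R :=
  fps_sum [set n : nat | (2 <= n)%N] (fun n => (t R N a n / n%:R) *:
    (fps_of_poly (power_sum R n) - fps_u R ^+ n)).

Definition gen_star : fps2 R :=
  1 + fps_sum [set kn : nat * nat | (2 * kn.2 <= kn.1)%N /\ (1 <= kn.2)%N]
        (fun kn => Gstar0 R N a kn.1 kn.2 kn.2 *: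
                     (fps_u R ^+ (kn.1 - 2 * kn.2) * fps_w R ^+ kn.2)).

(** By homogeneity only n = i + 2j contributes to the coefficient of u^i w^j. *)
Lemma exponentE i j : fcoef exponent i j = if (i + 2 * j < 2)%N then 0 else
  t R N a (i + 2 * j) / (i + 2 * j)%:R *
  fcoef (fps_of_poly (power_sum R (i + 2 * j)) - fps_u R ^+ (i + 2 * j)) i j.
Proof.
have z n : n != (i + 2 * j)%N ->
    fcoef (fps_of_poly (power_sum R n) - fps_u R ^+ n) i j = 0.
  move=> nij; rewrite fcoefB power_sum_homog ?fps_u_expE 1?eq_sym // sub0r.
  by case: eqP => [ni|]; case: eqP => [j0|]; rewrite ?oppr0 //; move: nij; lia.
case: ltnP => [ij2|ij2].
  rewrite [LHS]fsbig1 // => n n2; rewrite fcoefZ z ?mulr0 //.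
  by apply: contraTneq n2 => -> /=; rewrite -ltnNge.
rewrite [LHS](fsbigE [:: (i + 2 * j)%N]) //.
- by rewrite big_mkcond big_seq1 mem_set.
- by move=> n /=; rewrite inE => /eqP->.
by move=> n _; rewrite inE => /z nE; rewrite fcoefZ nE mulr0.
Qed.

Lemma gen_starE i j : fcoef gen_star i j =
  if j is 0 then (i == 0%N)%:R
  else \sum_(l <- compositions j i) tstar R N a l.
Proof.
rewrite fcoefD fcoef1; case: j => [|j].
  rewrite andbT [X in _ + X]fsbig1 ?addr0 // => -[k [|n]] [] // _ _.
  by rewrite fcoefZ fps_uw_expE andbF mulr0.
rewrite andbF add0r [LHS](fsbigE [:: (i + 2 * j.+1, j.+1)%N]) //.
- rewrite big_mkcond big_seq1 mem_set; last by split=> //=; lia.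
  by rewrite fcoefZ fps_uw_expE addnK !eqxx mulr1 Gstar0E.
- by move=> kn /=; rewrite inE => /eqP-> /=; split=> //; lia.
move=> [k n] [nk _]; rewrite inE => knE; rewrite /= in nk.
rewrite fcoefZ fps_uw_expE; case: eqP => [iE|]; rewrite ?mulr0 //.
case: eqP => [jE|]; rewrite ?mulr0 //; case/negP: knE.
by rewrite /= in iE jE; apply/eqP; congr pair; lia.
Qed.

Lemma cvg_gen_star i j :
  fcoef (gen_star_trunc n) i j @[n --> \oo] --> fcoef gen_star i j.
Proof.
rewrite gen_starE; case: j => [|j].
  by under eq_fun do rewrite gen_star_trunc_j0; exact: cvg_cst.
apply: cvg_sumr => l; rewrite mem_compositions => /and3P[_ l2 _].
exact: cvg_tstar.
Qed.

Lemma cvg_exponent i j :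
  fcoef (\sum_(p < n) local_dlog R (prog p)) i j @[n --> \oo] -->
  fcoef (euler exponent) i j.
Proof.
have prog_gt0 p : (0 < prog p)%N by exact: leq_ltn_trans (prog_gt N_gt0 a_gt0 p).
rewrite fcoef_euler exponentE.
under eq_fun do rewrite fcoef_sum.
under eq_fun do under eq_bigr do rewrite local_dlogE //.
case: ltnP => [ij2|ij2].
  by under eq_fun do rewrite big1_eq; rewrite mulr0; exact: cvg_cst.
under eq_fun do rewrite -mulr_suml.
(* The weight i + 2j produced by D cancels the 1/n of the exponent. *)
rewrite mulrA mulrCA mulfV ?mulr1; last by rewrite pnatr_eq0; lia.
by apply: cvgM; [exact: cvg_t|exact: cvg_cst].
Qed.

Lemma euler_gen_star : euler gen_star = euler exponent * gen_star.
Proof.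
apply/fps2P => i j.
have cvgL : (i + 2 * j)%:R * fcoef (gen_star_trunc n) i j @[n --> \oo] -->
    fcoef (euler gen_star) i j.
  by rewrite fcoef_euler; apply: cvgM; [exact: cvg_cst|exact: cvg_gen_star].
(* The same sequence is rewritten by the truncated equation; its coefficient is a finite sum of
   products, so limits may be taken factor by factor. *)
have cvgR : (i + 2 * j)%:R * fcoef (gen_star_trunc n) i j @[n --> \oo] -->
    fcoef (euler exponent * gen_star) i j; last first.
  by apply: (cvg_unique _ cvgL cvgR); exact: norm_hausdorff.
under eq_fun do rewrite -fcoef_euler euler_gen_star_trunc fcoefM.
rewrite fcoefM; apply: cvg_sumr => b _; apply: cvg_sumr => c _.
by apply: cvgM; [exact: cvg_exponent|exact: cvg_gen_star].
Qed.

Lemma gen_star_exp : gen_star = fps_exp exponent.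
Proof.
have e0 : fcoef exponent 0 0 = 0 by rewrite exponentE.
apply: (@euler_uniq _ (euler exponent)).
- by rewrite fcoef_euler mul0r.
- by rewrite fps_exp00 // gen_starE.
- exact: euler_gen_star.
exact: euler_exp.
Qed.

End Truncations.

(* x and y are taken in an arbitrary commutative ring L containing R[u,w];
   P n is the (unique) polynomial in u and w equal to x^n + y^n in L. *)
Theorem corollary2p10 (R : realType) (N a : nat)
    (hN : (0 < N)%N) (ha0 : (0 < a)%N) (haN : (a <= N)%N)
    (L : comNzRingType) (iota : {rmorphism {poly {poly R}} -> L})
    (iota_inj : injective iota) (x y : L)
    (hsum : x + y = iota (poly_u R)) (hprod : x * y = - iota (poly_w R)) :
  exists P : nat -> {poly {poly R}},
    (forall n : nat, iota (P n) = x ^+ n + y ^+ n) /\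
    1 + fps_sum [set kn : nat * nat | (2 * kn.2 <= kn.1)%N /\ (1 <= kn.2)%N]
          (fun kn => Gstar0 R N a kn.1 kn.2 kn.2 *:
                       (fps_u R ^+ (kn.1 - 2 * kn.2) * fps_w R ^+ kn.2))
    = fps_exp (fps_sum [set n : nat | (2 <= n)%N]
          (fun n => (t R N a n / n%:R) *:
                       (fps_of_poly (P n) - fps_u R ^+ n))).
Proof.
exists (power_sum R); split=> [n|]; first exact: power_sumE.
exact: gen_star_exp.
Qed.
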